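(* For every real $\alpha\ge 2$ we have $b(\alpha)=a(\alpha)/2$.
   Context: A graph means a finite graph, possibly with multiple (parallel) edges; each edge is a unit resistor, and $R_{xy}$ denotes effective resistance ($R_{xx}=0$; $R_{xy}=\infty$ if $x,y$ lie in different components). $e(G)$ is the number of edges. For an (unrooted) graph $G$ on $n$ vertices, $A'(G)=\frac1{n^2}\sum_{x,y\in V(G)}R_{xy}$. For a graph $G$ with a designated root vertex $\rho$, $B(G)=\frac{1}{|V(G)|-1}\sum_{x\in V(G)}R_{\rho x}$. Define $$a_n(\alpha)=\min\{A'(G):|V(G)|=n,\ e(G)\le \alpha n/2\},$$ $$b_n(\alpha)=\min\{B(G): G\text{ rooted},\ |V(G)|=n+1,\ e(G)\le \alpha n/2\},$$ and $a(\alpha)=\lim_{n\to\infty}a_n(\alpha)$, $b(\alpha)=\lim_{n\to\infty}b_n(\alpha)$; these limits exist for every $\alpha\ge 2$. *)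

(* Defs.v *)
From HB Require Import structures.
From mathcomp Require Import all_boot all_order all_algebra.
From mathcomp Require Import all_classical all_reals all_analysis.

Set Implicit Arguments.
Unset Strict Implicit.
Unset Printing Implicit Defensive.

Import Order.TTheory GRing.Theory Num.Theory.
Import numFieldNormedType.Exports.

Local Open Scope classical_set_scope.
Local Open Scope ring_scope.

(* A loopless finite multigraph on the vertex set V.  Each entry of the list
   is one edge, so a repeated entry is a parallel edge; neither the order of
   the list nor the orientation of its entries plays a role below. *)
Record multigraph (V : finType) := Multigraph {
  edges : seq (V * V);
  loopless : all (fun e => e.1 != e.2) edges
}.

Definition num_edges (V : finType) (G : multigraph V) : nat := size (edges G).

Definition adjacent (V : finType) (G : multigraph V) : rel V :=
  fun x y => ((x, y) \in edges G) || ((y, x) \in edges G).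

Section Resistance.
Variables (R : realType) (V : finType) (G : multigraph V).

(* By Ohm's law a unit resistor between z and w carries the current
   v z - v w from z to w. *)
Definition outflow (v : V -> R) (z : V) : R :=
  \sum_(e <- edges G | e.1 == z) (v z - v e.2) +
  \sum_(e <- edges G | e.2 == z) (v z - v e.1).

(* Kirchhoff's current law when a unit current enters at x and leaves at y. *)
Definition unit_current_potentials (x y : V) : set (V -> R) :=
  [set v | forall z, outflow v z = (z == x)%:R - (z == y)%:R].

(* When x and y are connected, a potential as above exists and the difference
   v x - v y is the same for all of them. *)
Definition resistance (x y : V) : \bar R :=
  if connect (adjacent G) x y then
    let v := xget (fun=> 0) (unit_current_potentials x y) in (v x - v y)%:E
  else +oo%E.

Definition avg_resistance : \bar R :=
  ((#|V|%:R ^- 2)%:E * \sum_(x : V) \sum_(y : V) resistance x y)%E.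

Definition root_resistance (rho : V) : \bar R :=
  ((#|V|.-1%:R^-1)%:E * \sum_(x : V) resistance rho x)%E.

End Resistance.

Section Extremal.
Variable R : realType.
Implicit Types (alpha : R) (n : nat).

Definition avg_resistances alpha n : set (\bar R) :=
  [set avg_resistance R G |
     G in [set G : multigraph 'I_n | (num_edges G)%:R <= alpha * n%:R / 2]].

Definition root_resistances alpha n : set (\bar R) :=
  [set root_resistance R Gr.1 Gr.2 |
     Gr in [set Gr : multigraph 'I_n.+1 * 'I_n.+1 |
              (num_edges Gr.1)%:R <= alpha * n%:R / 2]].

(* These infima are minima: see a_min_attained and b_min_attained. *)
Definition a_min alpha n : \bar R := ereal_inf (avg_resistances alpha n).

Definition b_min alpha n : \bar R := ereal_inf (root_resistances alpha n).

Definition a_lim alpha : \bar R := limn (a_min alpha).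

Definition b_lim alpha : \bar R := limn (b_min alpha).

Lemma finite_ereal_inf_attained (S : set (\bar R)) :
  finite_set S -> S !=set0 -> S (ereal_inf S).
Proof.
move=> /finite_seqP[s ->] [x0 /= x0s].
pose m := \big[Order.min/+oo%E]_(x <- s) x.
have mle x : x \in s -> (m <= x)%E.
  by move=> xs; exact: (@ge_bigmin_seq _ _ _ _ _ x predT id).
have ms : m \in s.
  rewrite {mle}/m; elim: s x0 x0s => // a [|b t] IH x0 _; rewrite big_cons.
    by rewrite big_nil minEle leey mem_head.
  rewrite minEle; case: ifP => _; first exact: mem_head.
  by rewrite inE (IH b) ?mem_head ?orbT.
suff -> : ereal_inf [set` s] = m by [].
apply/eqP; rewrite eq_le; apply/andP; split; first exact: ereal_inf_lbound.
by apply: le_ereal_inf_tmp => x /= xs; exact: mle.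
Qed.

Lemma finite_multigraphs (V : finType) (c : R) :
  finite_set [set G : multigraph V | (num_edges G)%:R <= c].
Proof.
pose m := Num.truncn c.
pose f (s : {bseq m of V * V}) : multigraph V :=
  Multigraph (seq.filter_all (fun e : V * V => e.1 != e.2) s).
apply: (@sub_finite_set _ _ (f @` [set: {bseq m of V * V}])); last first.
  exact/finite_image/finite_finset.
move=> [s hs] sc; rewrite /= /num_edges /= in sc.
have c0 : 0 <= c := le_trans (ler0n _ _) sc.
have sm : (size s <= m)%N by rewrite /m truncn_ge_nat.
exists (Bseq sm) => //; rewrite /f.
have es : seq.filter (fun e : V * V => e.1 != e.2) (Bseq sm) = s.
  exact/all_filterP.
by move: (seq.filter_all _ _); rewrite es => h; congr Multigraph;
  exact: bool_irrelevance.
Qed.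

Lemma a_min_attained alpha n :
  0 <= alpha -> avg_resistances alpha n (a_min alpha n).
Proof.
move=> a0; apply: finite_ereal_inf_attained.
  exact/finite_image/finite_multigraphs.
exists (avg_resistance R (@Multigraph 'I_n [::] isT)).
by exists (@Multigraph 'I_n [::] isT) => //=; rewrite !mulr_ge0.
Qed.

Lemma b_min_attained alpha n :
  0 <= alpha -> root_resistances alpha n (b_min alpha n).
Proof.
move=> a0; apply: finite_ereal_inf_attained.
  apply: finite_image.
  apply: (@sub_finite_set _ _
    ([set G : multigraph 'I_n.+1 | (num_edges G)%:R <= alpha * n%:R / 2]
       `*` [set: 'I_n.+1])); first by move=> [G r].
  by apply: finite_setX; [exact: finite_multigraphs | exact: finite_finset].
exists (root_resistance R (@Multigraph 'I_n.+1 [::] isT) ord0).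
exists (@Multigraph 'I_n.+1 [::] isT, ord0) => //=.
by rewrite !mulr_ge0.
Qed.

End Extremal.

(* Main.v *)
(* Write L for the Laplacian, K for its pseudo-inverse, and T for the trace of K,
   so that [avg_resistance G = 2 T / n] while the resistances to [rho] add up to
   [n K(rho,rho) + T].  This gives [a_(n+1) <= 2 b_n] at once.

   Conversely, the rows of K sum to zero, so k vertices can be chosen greedily
   whose normalised counting measure mu has [mu K mu <= T / (k n)].  Shorting
   them into a single root leaves, by Thomson's principle, an average resistance
   to the root of at most [(T / n) (1 + 1/k)], that is, half the average
   resistance of G up to the factor [1 + 1/k].  Shorting loses at most k vertices.
   For alpha > 2 they are replaced by vertices pendant at the root, together with
   a bounded number of further pendant vertices which restore the edge density.

   For alpha = 2 there is no room for extra edges, but [b_n <= 1] by the star.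
   In a connected graph with n vertices and at most n edges, pruning leaves away
   from the shorted set S leaves a core in which all but O(#|S|) vertices lie
   inside chains of vertices of degree 2; every vertex except those O(#|S|) is
   then at resistance at least 1 from S. *)
Require Import Defs.
From mathcomp Require Import all_boot all_order all_algebra.
From mathcomp Require Import all_classical all_reals all_analysis.
From mathcomp Require Import ring lra zify.

Import Order.TTheory GRing.Theory Num.Theory.
Import numFieldNormedType.Exports.

Local Open Scope ring_scope.

Set Implicit Arguments.
Unset Strict Implicit.

(** * Dirichlet form and resistance *)

Section Dirichlet.
Variables (R : realType) (V : finType) (G : multigraph V).
Implicit Types f g v : V -> R.

Definition dirichlet f g : R :=
  \sum_(e <- edges G) (f e.1 - f e.2) * (g e.1 - g e.2).

Definition energy f : R := \sum_(e <- edges G) (f e.1 - f e.2) ^+ 2.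

Lemma dirichletxx f : dirichlet f f = energy f.
Proof. by apply: eq_bigr => e _; rewrite expr2. Qed.

Lemma dirichletC f g : dirichlet f g = dirichlet g f.
Proof. by apply: eq_bigr => e _; rewrite mulrC. Qed.

Lemma energy_ge0 f : 0 <= energy f.
Proof. by apply: sumr_ge0 => e _; exact: sqr_ge0. Qed.

(** Summation by parts: the term of each edge is split between its two ends. *)
Lemma dirichlet_outflow f g : dirichlet f g = \sum_z f z * outflow G g z.
Proof.
under eq_bigr do rewrite mulrDr !big_distrr /=.
rewrite big_split /= (exchange_big_dep predT) //=.
rewrite [X in _ + X](exchange_big_dep predT) //=.
rewrite -big_split /=; apply: eq_bigr => e _.
rewrite (big_pred1 e.1) => [|z]; last by rewrite /= eq_sym.
rewrite (big_pred1 e.2) => [|z]; last by rewrite /= eq_sym.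
ring.
Qed.

Lemma dirichletDl f1 f2 g :
  dirichlet (fun z => f1 z + f2 z) g = dirichlet f1 g + dirichlet f2 g.
Proof. by rewrite -big_split /=; apply: eq_bigr => e _; ring. Qed.

Lemma dirichletZl a f g : dirichlet (fun z => a * f z) g = a * dirichlet f g.
Proof. by rewrite big_distrr; apply: eq_bigr => e _ /=; ring. Qed.

Lemma dirichlet_sumr (I : Type) (s : seq I) f (g : I -> V -> R) :
  dirichlet f (fun z => \sum_(i <- s) g i z) = \sum_(i <- s) dirichlet f (g i).
Proof.
rewrite exchange_big; apply: eq_bigr => e _ /=.
by rewrite -sumrB big_distrr.
Qed.

Lemma energyD f g t :
  energy (fun z => f z - t * g z) =
  energy f - 2 * t * dirichlet f g + t ^+ 2 * energy g.
Proof.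
rewrite /energy /dirichlet !big_distrr -sumrB -big_split /=.
by apply: eq_bigr => e _; ring.
Qed.

Lemma dirichlet_cauchy_schwarz f g : dirichlet f g ^+ 2 <= energy f * energy g.
Proof.
have [g0|gn0] := eqVneq (energy g) 0.
  have h t : 0 <= energy f - 2 * t * dirichlet f g.
    by have := energy_ge0 (fun z => f z - t * g z); rewrite energyD g0 mulr0 addr0.
  have [->|d0] := eqVneq (dirichlet f g) 0; first by rewrite expr0n g0 mulr0.
  (* The bound [h] is affine in [t]; at this [t] its right-hand side would be -1. *)
  have := h ((energy f + 1) / (2 * dirichlet f g)).
  rewrite (_ : 2 * _ * _ = energy f + 1); first by lra.
  by field.
have gp : 0 < energy g by rewrite lt_neqAle eq_sym gn0 energy_ge0.
pose t := dirichlet f g / energy g.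
have := mulr_ge0 (energy_ge0 (fun z => f z - t * g z)) (ltW gp).
rewrite energyD -[in X in _ -> X]subr_ge0.
suff -> : (energy f - 2 * t * dirichlet f g + t ^+ 2 * energy g) * energy g =
  energy f * energy g - dirichlet f g ^+ 2 by [].
by rewrite /t; field.
Qed.

Lemma energy_eq0P f :
  energy f = 0 <-> forall e, e \in edges G -> f e.1 = f e.2.
Proof.
split=> [/eqP|fE].
  rewrite psumr_eq0; last by move=> e _; exact: sqr_ge0.
  by move=> /allP fE e /fE; rewrite sqrf_eq0 subr_eq0 => /eqP.
by rewrite /energy big_seq big1 // => e /fE ->; rewrite subrr expr0n.
Qed.

(** Zero energy means constant on components; for the converse, the indicator of the component of
    [x] is tested. *)
Lemma connect_energy0P x y :
  connect (Defs.adjacent G) x y <-> forall f, energy f = 0 -> f x = f y.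
Proof.
split=> [/connectP[p + ->] f /energy_eq0P f0 {y}|h].
  elim: p x => //= y p IH x /andP[/orP[/f0|/f0] /= exy /IH <-//].
pose f z : R := (connect (Defs.adjacent G) x z)%:R.
have /h : energy f = 0.
  apply/energy_eq0P => -[u w] uw; rewrite /f /=; congr (nat_of_bool _)%:R.
  apply/idP/idP => /connect_trans; apply; apply: connect1.
    by rewrite /Defs.adjacent uw.
  by rewrite /Defs.adjacent uw orbT.
rewrite /f connect0 => /esym/eqP; case: (connect _ x y) => //.
by rewrite eq_sym oner_eq0.
Qed.

Definition connected_graph := forall x y, connect (Defs.adjacent G) x y.

Lemma connected_energy0 f : connected_graph -> energy f = 0 -> forall x y, f x = f y.
Proof. by move=> cG f0 x y; have /connect_energy0P := cG x y; exact. Qed.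

(** Pairing [f] with a unit potential gives [f x - f y]. By symmetry of the form, [v] and the
    potential picked by [xget] have the same drop, so the choice is immaterial. *)
Lemma resistanceE x y v : connect (Defs.adjacent G) x y ->
  unit_current_potentials G x y v -> resistance R G x y = (energy v)%:E.
Proof.
move=> cxy vP; rewrite /resistance cxy.
set w := xget _ _.
have wP : unit_current_potentials G x y w by rewrite /w; case: xgetP => // /(_ v).
have D f u : unit_current_potentials G x y u -> dirichlet f u = f x - f y.
  move=> uP; rewrite dirichlet_outflow.
  under eq_bigr do rewrite uP mulrBr.
  rewrite sumrB (bigD1 x) //= eqxx mulr1 big1 ?addr0; last first.
    by move=> z /negPf ->; rewrite mulr0.
  rewrite (bigD1 y) //= eqxx mulr1 big1 ?addr0 // => z /negPf ->.
  by rewrite mulr0.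
by rewrite -(D _ v) // dirichletC (D _ w) // -(D _ v) // dirichletxx.
Qed.

End Dirichlet.

(** * Green kernel of a connected graph *)

Lemma outflowE (R : realType) (V : finType) (G : multigraph V) (h : V -> R) z :
  outflow G h z = dirichlet G (fun y => (y == z)%:R) h.
Proof.
rewrite dirichlet_outflow (bigD1 z) //= eqxx mul1r big1 ?addr0 // => y /negPf ->.
by rewrite mul0r.
Qed.

Section Green.
Variables (R : realType) (n : nat) (G : multigraph 'I_n).
Hypothesis cG : connected_graph G.

(** The Laplacian [L] is symmetric and, by connectedness, its kernel consists of constants; so its
    row space contains every vector of sum zero. *)
Lemma outflow_surj (c : 'I_n -> R) :
  \sum_z c z = 0 -> exists v, forall z, outflow G v z = c z.
Proof.
move=> c0; pose d (i : 'I_n) z : R := (z == i)%:R.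
pose L := \matrix_(i, j) dirichlet G (d i) (d j).
pose C := cokermx L.
have Ccst k i j : C i k = C j k.
  apply: (@connected_energy0 R _ G (fun i => C i k)) => //.
  rewrite -dirichletxx dirichlet_outflow big1 // => z _.
  have /matrixP/(_ z k) := mulmx_coker L.
  rewrite !mxE outflowE dirichletC dirichlet_outflow.
  under eq_bigr do rewrite mxE dirichletC -outflowE.
  under [X in _ -> _ * X = _]eq_bigr do rewrite mulrC.
  by move=> ->; rewrite mulr0.
have /submxP[v cv] : (\row_z c z <= L)%MS.
  rewrite submxE; apply/eqP/rowP => k; rewrite !mxE.
  have [z|/= z0] := pickP (@predT 'I_n); last first.
    by apply: big1 => i; have := z0 i.
  under eq_bigr => i _ do rewrite mxE -/C (Ccst k i z).
  by rewrite -big_distrl /= c0 mul0r.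
exists (v 0) => z; have /rowP/(_ z) := cv; rewrite !mxE => ->.
rewrite outflowE dirichletC dirichlet_outflow; apply: eq_bigr => i _.
by rewrite mxE outflowE.
Qed.

Lemma resistance_energy x y : exists2 v : 'I_n -> R,
  resistance R G x y = (energy G v)%:E & energy G v = v x - v y.
Proof.
have [|v vP] := outflow_surj (c := fun z => (z == x)%:R - (z == y)%:R).
  rewrite sumrB (bigD1 x) //= big1 => [|z /negPf-> //].
  by rewrite (bigD1 y) //= big1 => [|z /negPf-> //]; rewrite !eqxx subrr.
exists v; first exact: resistanceE.
rewrite -dirichletxx dirichlet_outflow; under eq_bigr do rewrite vP mulrBr.
rewrite sumrB (bigD1 x) //= eqxx mulr1 big1 ?addr0 => [|z /negPf->]; last first.
  by rewrite mulr0.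
by rewrite (bigD1 y) //= eqxx mulr1 big1 ?addr0 // => z /negPf ->; rewrite mulr0.
Qed.

Lemma green_exists : exists g : 'I_n -> 'I_n -> R,
  forall x z, outflow G (g x) z = (z == x)%:R - n%:R^-1.
Proof.
suff h x : exists v : 'I_n -> R, forall z, outflow G v z = (z == x)%:R - n%:R^-1.
  by have [g] := choice h; exists g.
apply: outflow_surj; rewrite sumrB (bigD1 x) //= eqxx big1 => [|z /negPf-> //].
rewrite sumr_const card_ord -[_ *+ n]mulr_natl divff ?addr0 ?subrr //.
by case: n x => [[]|m _] //; rewrite pnatr_eq0.
Qed.

Variable g : 'I_n -> 'I_n -> R.
Hypothesis gP : forall x z, outflow G (g x) z = (z == x)%:R - n%:R^-1.

(** Each [g x] is determined up to an additive constant, which the Dirichlet form ignores: [K] is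
    the pseudo-inverse of the Laplacian. *)
Let K x y := dirichlet G (g x) (g y).
Let T := \sum_x energy G (g x).

Lemma dirichlet_green f x : dirichlet G f (g x) = f x - n%:R^-1 * \sum_z f z.
Proof.
rewrite dirichlet_outflow; under eq_bigr do rewrite gP mulrBr.
rewrite sumrB -mulr_suml [_ * n%:R^-1]mulrC (bigD1 x) //= eqxx mulr1 big1 ?addr0 //.
by move=> z /negPf ->; rewrite mulr0.
Qed.

(** With [f = g y]: the rows of [K] sum to zero. *)
Lemma sum_dirichlet_green f : \sum_x dirichlet G f (g x) = 0.
Proof.
under eq_bigr do rewrite dirichlet_green.
rewrite sumrB sumr_const card_ord -[_ *+ n]mulr_natl mulrA.
have [n0|n0] := eqVneq n 0%N; last by rewrite divff ?pnatr_eq0 // mul1r subrr.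
by rewrite big1 ?mulr0 ?subrr // => i; have := ltn_ord i; rewrite {2}n0.
Qed.

(** The uniform sinks of [g x] and [g y] cancel, so [g x - g y] is a unit current potential. *)
Lemma resistance_green x y :
  resistance R G x y = (K x x + K y y - 2 * K x y)%:E.
Proof.
rewrite (@resistanceE _ _ _ _ _ (fun z => g x z - 1 * g y z)) //; last first.
  move=> z; rewrite outflowE dirichletC dirichletDl.
  rewrite (_ : (fun z => - _) = (fun z => -1 * g y z)); last first.
    by apply/funext => w; ring.
  by rewrite dirichletZl !(dirichletC _ (g _)) -!outflowE !gP; ring.
by rewrite energyD -!dirichletxx /K; congr EFin; ring.
Qed.

Lemma sum_resistance x :
  (\sum_y resistance R G x y)%E = (n%:R * K x x + T)%:E.
Proof.
under eq_bigr do rewrite resistance_green.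
rewrite sumEFin sumrB big_split /= sumr_const card_ord -mulr_sumr sum_dirichlet_green.
rewrite mulr0 subr0 -[_ *+ n]mulr_natl; congr (_ + _)%:E.
Qed.

Lemma avg_resistance_green :
  (0 < n)%N -> avg_resistance R G = (2 * T / n%:R)%:E.
Proof.
move=> n0; rewrite /avg_resistance; under eq_bigr do rewrite sum_resistance.
rewrite sumEFin card_ord -EFinM; congr EFin.
rewrite big_split /= sumr_const card_ord -mulr_sumr.
under eq_bigr do rewrite /K dirichletxx.
rewrite -/T -[_ *+ n]mulr_natl; field.
by rewrite pnatr_eq0 -lt0n.
Qed.

End Green.

(** * Grounding a small set of vertices *)

Lemma exists_le_sum (R : realType) (n : nat) (F : 'I_n -> R) :
  (0 < n)%N -> exists i, n%:R * F i <= \sum_j F j.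
Proof.
move=> n0; apply: contrapT => /forallNP h.
have : \sum_(i < n) \sum_(j < n) F j < \sum_(i < n) n%:R * F i.
  apply: ltr_sum => [|i _]; last by rewrite ltNge; apply/negP/h.
  by apply/hasP; exists (Ordinal n0); rewrite ?mem_index_enum.
by rewrite sumr_const card_ord -mulr_sumr mulr_natl ltxx.
Qed.

Section Grounding.
Variables (R : realType) (n : nat) (G : multigraph 'I_n).
Hypothesis n_gt0 : (0 < n)%N.
Variable g : 'I_n -> 'I_n -> R.
Hypothesis gP : forall x z, outflow G (g x) z = (z == x)%:R - n%:R^-1.

Let T := \sum_x energy G (g x).

(* The average over [s] of the increment [K s s + 2 \sum_(t <- S) K s t] is
   [T / n], since the rows of the Green kernel [K] sum to zero; hence the points
   can be chosen greedily. *)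
Lemma exists_small_green_energy k : exists2 S : seq 'I_n, size S = k &
  n%:R * energy G (fun z => \sum_(t <- S) g t z) <= k%:R * T.
Proof.
elim: k => [|k [S sS IH]].
  exists [::] => //; rewrite /energy big1 ?mulr0 ?mul0r // => e _.
  by rewrite !big_nil subrr expr0n.
pose m z := \sum_(t <- S) g t z.
have [s] := exists_le_sum (fun s => energy G (g s) + 2 * dirichlet G (g s) m) n_gt0.
rewrite big_split -mulr_sumr /= -/T.
under [X in _ <= _ + 2 * X]eq_bigr do rewrite dirichletC.
rewrite (sum_dirichlet_green gP) mulr0 addr0 => hs.
exists (s :: S); first by rewrite /= sS.
rewrite (_ : (fun z => _) = (fun z => m z - (-1) * g s z)); last first.
  by apply/funext => z; rewrite big_cons /m; ring.
rewrite energyD [dirichlet G m _]dirichletC -natr1 mulrDl mul1r.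
have := lerD IH hs; rewrite -/m -mulrDr.
by congr (n%:R * _ <= _); ring.
Qed.

(** Let [r x] be the energy of a unit current from [x] to the uniform measure on the greedy points.
    In the sum of [r] the cross terms vanish, which leaves [T] plus at most [T / k]. If [f] vanishes
    on [S], pairing it with this current gives [f x], since the mean terms cancel; Cauchy-Schwarz
    concludes. *)
Lemma exists_ground k : (0 < k)%N -> exists S : {set 'I_n}, exists r : 'I_n -> R,
  [/\ exists s, s \in S, (#|S| <= k)%N, \sum_x r x <= T * (1 + k%:R^-1),
      forall x, 0 <= r x &
      forall f, {in S, forall s, f s = 0} -> forall x, f x ^+ 2 <= r x * energy G f].
Proof.
move=> k0; have [S sS QS] := exists_small_green_energy k.
have kN0 : k%:R != 0 :> R by rewrite pnatr_eq0 -lt0n.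
pose m z := \sum_(t <- S) g t z.
exists [set x in S], (fun x => energy G (fun z => g x z - k%:R^-1 * m z)); split.
- case: S sS {QS m} => [sS|s S _]; first by rewrite -sS in k0.
  by exists s; rewrite inE mem_head.
- by rewrite cardsE -sS card_size.
- under eq_bigr do rewrite energyD dirichletC.
  rewrite big_split sumrB -/T -mulr_sumr (sum_dirichlet_green gP) mulr0 subr0 /=.
  rewrite sumr_const card_ord mulrDr mulr1 lerD2l.
  have k_gt0 : 0 < k%:R :> R by rewrite ltr0n.
  rewrite -[_ *+ n]mulr_natl mulrCA expr2 -mulrA [T * _]mulrC.
  by rewrite ler_pM2l ?invr_gt0 // ler_pdivrMl.
- by move=> x; exact: energy_ge0.
move=> f fS x; rewrite mulrC.
suff -> : f x = dirichlet G f (fun z => g x z - k%:R^-1 * m z).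
  exact: dirichlet_cauchy_schwarz.
have fm : dirichlet G f m = - k%:R * (n%:R^-1 * \sum_z f z).
  rewrite dirichlet_sumr big_seq.
  under eq_bigr => t tS do rewrite (dirichlet_green gP) fS ?inE // add0r.
  by rewrite -big_seq big_const_seq count_predT iter_addr_0 sS; ring.
rewrite dirichletC dirichletDl dirichletC (dirichlet_green gP).
rewrite (_ : (fun z => - _) = (fun z => - k%:R^-1 * m z)); last first.
  by apply/funext => w; ring.
rewrite dirichletZl dirichletC fm.
by field; rewrite kN0 pnatr_eq0 -lt0n n_gt0.
Qed.

End Grounding.

(** * Infinite resistances of disconnected graphs *)

Section Disconnected.
Variables (R : realType) (V : finType) (G : multigraph V).


Lemma resistance_gtNy x y : resistance R G x y != -oo%E.
Proof. by rewrite /resistance; case: ifP. Qed.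

Lemma sum_resistance_gtNy x : (\sum_y resistance R G x y)%E != -oo%E.
Proof.
apply/negP => /eqP /esum_eqNyP[y [_ _ /eqP]].
by rewrite (negPf (resistance_gtNy _ _)).
Qed.

Lemma adjacent_connect_sym : connect_sym (Defs.adjacent G).
Proof. by apply: sym_connect_sym => x y; rewrite /Defs.adjacent orbC. Qed.

Lemma sum_resistance_disconnected x :
  ~ connected_graph G -> (\sum_y resistance R G x y)%E = +oo%E.
Proof.
move=> nG; have [/forallP h|] := boolP [forall y, connect (Defs.adjacent G) x y].
  case: nG => y z; apply: connect_trans (h z).
  by rewrite adjacent_connect_sym.
rewrite negb_forall => /existsP[y xy].
apply/esum_eqyP; first by move=> ? _; exact: resistance_gtNy.
by exists y; split=> //; rewrite /resistance (negPf xy).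
Qed.

End Disconnected.

Lemma root_resistance_disconnected (R : realType) n (G : multigraph 'I_n.+1) rho :
  (0 < n)%N -> ~ connected_graph G -> root_resistance R G rho = +oo%E.
Proof.
move=> n0 nG; rewrite /root_resistance sum_resistance_disconnected //.
by rewrite gt0_muley // lte_fin invr_gt0 ltr0n card_ord.
Qed.

Lemma avg_resistance_disconnected (R : realType) n (G : multigraph 'I_n) :
  (0 < n)%N -> ~ connected_graph G -> avg_resistance R G = +oo%E.
Proof.
move=> n0 nG; rewrite /avg_resistance.
suff -> : (\sum_x \sum_y resistance R G x y = +oo)%E.
  by rewrite gt0_muley // lte_fin invr_gt0 exprn_gt0 // ltr0n card_ord.
apply/esum_eqyP; first by move=> ? _; exact: sum_resistance_gtNy.
exists (Ordinal n0); rewrite mem_index_enum; split=> //.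
exact: sum_resistance_disconnected.
Qed.

(** For connected [G] the sides are [2 T / (n + 1)] and [2 ((n + 1) E + T) / n], where [E], the
    energy of [g rho], and [T] are nonnegative. *)
Lemma avg_le_root_resistance (R : realType) n (G : multigraph 'I_n.+1) rho :
  (0 < n)%N -> (avg_resistance R G <= 2%:E * root_resistance R G rho)%E.
Proof.
move=> n0; have [cG|nG] := pselect (connected_graph G); last first.
  by rewrite root_resistance_disconnected // gt0_muley ?leey // lte_fin.
have [g gP] := green_exists R cG.
rewrite (avg_resistance_green cG gP) // /root_resistance (sum_resistance cG gP).
rewrite card_ord /= -!EFinM lee_fin.
set T := \sum_x _; rewrite dirichletxx.
have T0 : 0 <= T by apply: sumr_ge0 => x _; exact: energy_ge0.
have E0 := energy_ge0 G (g rho).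
rewrite ler_pdivrMr ?ltr0n //.
have n0' : 0 < n%:R :> R by rewrite ltr0n.
rewrite -(ler_pM2l n0').
rewrite [leRHS](_ : _ = 2 * n.+1%:R * (n.+1%:R * energy G (g rho) + T)); last first.
  by field; rewrite gt_eqF.
rewrite -natr1; nra.
Qed.

Lemma avg_resistance_ge0 (R : realType) n (G : multigraph 'I_n) :
  (0 < n)%N -> (0 <= avg_resistance R G)%E.
Proof.
move=> n0; have [cG|nG] := pselect (connected_graph G); last first.
  by rewrite avg_resistance_disconnected.
have [g gP] := green_exists R cG.
rewrite (avg_resistance_green cG gP) // lee_fin divr_ge0 ?mulr_ge0 //.
by apply: sumr_ge0 => x _; exact: energy_ge0.
Qed.

(* By Thomson's principle the condition on [f] says that the effective
   resistance between [x] and the shorted set [S] is at most [r x]. *)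
Lemma avg_resistance_ground (R : realType) n k (G : multigraph 'I_n) (A : R) :
    (0 < n)%N -> (0 < k)%N -> avg_resistance R G = A%:E ->
  exists S : {set 'I_n}, exists r : 'I_n -> R,
  [/\ exists s, s \in S, (#|S| <= k)%N,
      \sum_x r x <= n%:R * (A / 2) * (1 + k%:R^-1), forall x, 0 <= r x &
      forall f, {in S, forall s, f s = 0} -> forall x, f x ^+ 2 <= r x * energy G f].
Proof.
move=> n0 k0 GA; have [cG|nG] := pselect (connected_graph G); last first.
  by move: GA; rewrite avg_resistance_disconnected.
have [g gP] := green_exists R cG.
have [S [r [S0 Sk rT r0 rS]]] := exists_ground n0 gP k0.
exists S, r; split=> //; apply: le_trans rT _.
move: GA; rewrite (avg_resistance_green cG gP) // => -[<-].
rewrite le_eqVlt; apply/orP; left; apply/eqP; congr (_ * _).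
by field; rewrite pnatr_eq0 -lt0n.
Qed.

(** * Shorting a set of vertices into a root *)

Section Collapse.
Variables (n d : nat) (G : multigraph 'I_n) (S : {set 'I_n}).

Let W : finType := 'I_(n + d).+1.
Let rho : W := ord_max.

Definition collapse_embed (x : 'I_n) : W := inord x.

Definition collapse_map (x : 'I_n) : W := if x \in S then rho else collapse_embed x.

Definition collapse_pendant : {set W} := ~: (rho |: collapse_embed @: ~: S).

(** Edges with both ends in [S] would become loops; dropping them changes no energy. *)
Definition collapse_edges : seq (W * W) :=
  [seq e <- [seq (collapse_map e.1, collapse_map e.2) | e <- edges G] | e.1 != e.2]
  ++ [seq (w, rho) | w <- enum collapse_pendant].

Lemma collapse_loopless : all (fun e => e.1 != e.2) collapse_edges.
Proof.
rewrite all_cat filter_all all_map; apply/allP => w /=.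
by rewrite mem_enum !inE negb_or => /andP[].
Qed.

(* [S] is merged into the single vertex [rho]; the labels left free by [S] and
   [d] further labels carry vertices pendant at [rho]. *)
Definition collapse : multigraph W := Multigraph collapse_loopless.

Lemma collapse_embedE x : collapse_embed x = x :> nat.
Proof. by rewrite inordK // ltnS (leq_trans (ltnW (ltn_ord x))) // leq_addr. Qed.

Lemma collapse_embed_inj : injective collapse_embed.
Proof.
by move=> x y /(congr1 (@nat_of_ord _)); rewrite !collapse_embedE => /val_inj.
Qed.

Lemma collapse_embed_root x : (rho == collapse_embed x) = false.
Proof.
apply/eqP => /(congr1 (@nat_of_ord _)); rewrite collapse_embedE /= => e.
by have := ltn_ord x; rewrite -e ltnNge leq_addr.
Qed.

Lemma collapse_root_notin : rho \notin collapse_embed @: ~: S.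
Proof. by apply/imsetP => -[x _ /eqP]; rewrite collapse_embed_root. Qed.

Lemma card_collapse_pendant : #|collapse_pendant| = (#|S| + d)%N.
Proof.
have := cardsC (rho |: collapse_embed @: ~: S).
rewrite cardsU1 collapse_root_notin card_imset; last exact: collapse_embed_inj.
rewrite -/collapse_pendant !card_ord => /eqP; rewrite add1n addSn eqSS.
have := cardsC S; rewrite card_ord addnC => /esym cS.
by rewrite [X in _ == (X + d)%N]cS -addnA eqn_add2l => /eqP.
Qed.

Lemma num_edges_collapse : (num_edges collapse <= num_edges G + (#|S| + d))%N.
Proof.
rewrite /num_edges /= size_cat size_map -cardE card_collapse_pendant leq_add2r.
by rewrite size_filter (leq_trans (count_size _ _)) // size_map.
Qed.

Variable R : realType.

Lemma energy_collapse (v : W -> R) : energy collapse v =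
  energy G (v \o collapse_map) + \sum_(w in collapse_pendant) (v w - v rho) ^+ 2.
Proof.
rewrite /energy big_cat /= big_filter !big_map big_enum /=; congr (_ + _).
rewrite big_mkcond; apply: eq_bigr => e _ /=; case: eqP => // ->.
by rewrite subrr expr0n.
Qed.

Lemma energy_collapse_map (v : W -> R) :
  energy G (v \o collapse_map) <= energy collapse v.
Proof.
rewrite energy_collapse lerDl; apply: sumr_ge0 => w _; exact: sqr_ge0.
Qed.

Lemma energy_collapse_pendant (v : W -> R) w :
  w \in collapse_pendant -> (v w - v rho) ^+ 2 <= energy collapse v.
Proof.
move=> wP; rewrite energy_collapse (bigD1 w) //= addrCA lerDl addr_ge0 ?energy_ge0 //.
by apply: sumr_ge0 => u _; exact: sqr_ge0.
Qed.

Variable r : 'I_n -> R.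
Hypothesis r_ge0 : forall x, 0 <= r x.
Hypothesis rP : forall f, {in S, forall s, f s = 0} ->
  forall x, f x ^+ 2 <= r x * energy G f.

Let pullback (v : W -> R) x := v (collapse_map x) - v rho.

(** The pullback vanishes on [S], so [rP] applies, and its energy is that of [v] without the pendant
    edges. *)
Lemma pullback_sqr (v : W -> R) x :
  pullback v x ^+ 2 <= r x * energy collapse v.
Proof.
apply: le_trans (_ : r x * energy G (pullback v) <= _).
  by apply: rP => s sS; rewrite /pullback /collapse_map sS subrr.
rewrite ler_wpM2l //.
apply: le_trans (energy_collapse_map v).
rewrite le_eqVlt; apply/orP; left; apply/eqP; apply: eq_bigr => e _.
by rewrite /pullback /=; ring.
Qed.

Variant collapse_spec : W -> Type :=
| CollapseRoot : collapse_spec rho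
| CollapseEmbed x of x \notin S : collapse_spec (collapse_embed x)
| CollapsePendant w of w \in collapse_pendant : collapse_spec w.

Lemma collapseP w : collapse_spec w.
Proof.
have [wP|] := boolP (w \in collapse_pendant); first exact: CollapsePendant.
rewrite inE negbK in_setU1; case: eqP => [-> _|_ /=]; first exact: CollapseRoot.
by move=> /imsetP/cid2[x + ->]; rewrite inE; exact: CollapseEmbed.
Qed.

Lemma connected_collapse : connected_graph collapse.
Proof.
suff h (f : W -> R) : energy collapse f = 0 -> forall w, f w = f rho.
  move=> x y; apply/(@connect_energy0P R) => f /h fr.
  by rewrite !fr.
move=> f0 w; apply/eqP; rewrite -subr_eq0 -sqrf_eq0.
case: (collapseP w) => [|x xS|{}w wP]; first by rewrite subrr expr0n.
  have := pullback_sqr f x; rewrite f0 mulr0 /pullback /collapse_map (negPf xS).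
  by move=> h; rewrite eq_le h sqr_ge0.
by rewrite eq_le sqr_ge0 andbT -f0 energy_collapse_pendant.
Qed.

(** For a unit current between [rho] and [w], voltage drop, energy and resistance coincide. Dividing
    the bounds on the squared drop by the energy bounds the resistance by [r x] at an embedded
    vertex and by 1 at a pendant one. *)
Lemma root_resistance_collapse : (0 < n + d)%N ->
  (root_resistance R collapse rho <=
   ((n + d)%:R^-1 * (\sum_x r x + (#|S| + d)%:R))%:E)%E.
Proof.
move=> nd0; have cH := connected_collapse.
have /choice[F FP] : forall w, exists c : R, resistance R collapse rho w = c%:E /\
  [/\ w = rho -> c = 0, w \in collapse_pendant -> c <= 1 &
    forall x, x \notin S -> w = collapse_embed x -> c <= r x].
  move=> w; have [v -> vE] := resistance_energy R cH rho w.
  have E0 := energy_ge0 collapse v.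
  exists (energy collapse v); split=> //; split.
  - by rewrite vE => ->; rewrite subrr.
  - move=> /(energy_collapse_pendant v); rewrite -opprB -vE sqrrN => h.
    rewrite leNgt; apply/negP => h1.
    have := ltr_pM2l (lt_trans ltr01 h1) 1 (energy collapse v).
    by rewrite h1 mulr1 -expr2 ltNge h.
  - move=> x xS wx; have := pullback_sqr v x.
    rewrite /pullback /collapse_map (negPf xS) -wx -opprB -vE sqrrN.
    have [->//|En0] := eqVneq (energy collapse v) 0.
    by rewrite expr2 ler_pM2r // lt_neqAle eq_sym En0.
rewrite /root_resistance; under eq_bigr do rewrite (FP _).1.
rewrite sumEFin card_ord lee_fin ler_pM2l ?invr_gt0 ?ltr0n //.
rewrite (bigID (mem collapse_pendant)) /= addrC lerD //.
  rewrite (eq_bigl (fun w => w \in rho |: collapse_embed @: ~: S)) => [|w]; last first.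
    by rewrite !inE negbK.
  rewrite big_setU1 ?collapse_root_notin //=.
  have [_ [-> // _ _]] := FP rho; rewrite add0r big_imset /=; last first.
    by move=> x y _ _; exact: collapse_embed_inj.
  rewrite [leRHS](bigID (fun x => x \in ~: S)) /= ler_wpDr ?sumr_ge0 //.
  apply: ler_sum => x; rewrite inE => xS.
  by have [_ [_ _]] := FP (collapse_embed x); exact.
rewrite -card_collapse_pendant -sum1_card natr_sum.
by apply: ler_sum => w wP; have [_ [_ + _]] := FP w; exact.
Qed.

End Collapse.

(** * Pruning graphs with few edges *)

Section Pruning.
Variables (R : realType) (V : finType) (G : multigraph V).
Hypothesis cG : connected_graph G.
Variable S : {set V}.
Hypothesis S_gt0 : exists s, s \in S.
Implicit Types (A B : {set V}) (x y z u : V) (e : V * V) (f : V -> R).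

Let inside A e := (e.1 \in A) && (e.2 \in A).
Let incident x e := (e.1 == x) || (e.2 == x).
Let star A x := [seq e <- edges G | inside A e && incident x e].
Let opposite x e := if e.1 == x then e.2 else e.1.
Let nbr A x := [set y in [seq opposite x e | e <- star A x]].
Let energy_in A f := \sum_(e <- edges G | inside A e) (f e.1 - f e.2) ^+ 2.
Let num_edges_in A := count (inside A) (edges G).

(** By Dirichlet's principle, a certificate that the resistance from [x] to the shorted set [S] is
    at least 1. *)
Let unit_cut x := exists f, [/\ {in S, forall s, f s = 0}, f x = 1 & energy G f <= 1].

(** Invariant of the pruning: the removed vertices hang off [A] in trees, so values on [A] extend at
    no extra energy. *)
Let extendable A := forall f, exists2 f',
  {in A, f' =1 f} & energy G f' <= energy_in A f.

Lemma edge_neq e : e \in edges G -> e.1 != e.2.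
Proof. by have /allP := loopless G; exact. Qed.

Lemma inside_setD1 A x e :
  inside (A :\ x) e = inside A e && ~~ incident x e.
Proof.
rewrite /inside /incident !inE negb_or.
by case: (e.1 == x); case: (e.2 == x); rewrite ?andbF ?andbT.
Qed.

Lemma energy_in_setD1 A x f : energy_in A f =
  energy_in (A :\ x) f + \sum_(e <- star A x) (f e.1 - f e.2) ^+ 2.
Proof.
rewrite /energy_in (bigID (incident x)) [LHS]addrC /= [in RHS]big_filter.
by congr (_ + _); apply: eq_bigl => e; rewrite inside_setD1.
Qed.

Lemma num_edges_in_setD1 A x :
  num_edges_in A = (num_edges_in (A :\ x) + size (star A x))%N.
Proof.
rewrite /num_edges_in size_filter -(count_predUI _ _ (edges G)).
rewrite [X in (_ + X)%N](@eq_count _ _ pred0) => [|e]; last first.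
  by rewrite /= inside_setD1; case: (incident x e); rewrite ?andbF.
rewrite count_pred0 addn0; apply: eq_count => e; rewrite /= inside_setD1.
by case: (incident x e); rewrite ?andbF ?orbF ?andbT.
Qed.

Lemma mem_star A x e : e \in star A x = [&& e \in edges G, inside A e & incident x e].
Proof. by rewrite mem_filter andbC. Qed.

(** The indicator of [x] extends from [A] with energy at most the degree of [x] in [A], which gives
    the cut; degree 0 would contradict connectedness. To extend from [A :\ x], [x] copies the value
    of its only neighbour. *)
Lemma prune_leaf A x : S \subset A -> extendable A -> x \in A -> x \notin S ->
  (size (star A x) <= 1)%N ->
  [/\ unit_cut x, extendable (A :\ x) & size (star A x) = 1%N].
Proof.
move=> SA extA xA xS st1.
have [f' f'A Ef'] := extA (fun z => (z == x)%:R).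
have f'S : {in S, forall s, f' s = 0}.
  move=> s sS; rewrite f'A ?(fintype.subsetP SA) //.
  by case: eqP => // sx; rewrite -sx sS in xS.
have f'x : f' x = 1 by rewrite f'A // eqxx.
have Est : energy G f' <= (size (star A x))%:R.
  apply: le_trans Ef' _; rewrite (energy_in_setD1 _ x) [X in X + _]big1.
    rewrite add0r -sum1_size natr_sum; apply: ler_sum => e _.
    by case: (e.1 == x); case: (e.2 == x); rewrite /=; lra.
  move=> e; rewrite inside_setD1 negb_or => /andP[_ /andP[/negPf -> /negPf ->]].
  by rewrite subrr expr0n.
have st : size (star A x) = 1%N.
  move: st1 Est; case: (size _) => [_ E0|[|//] _ _] //.
  have [s sS] := S_gt0.
  have f'0 : energy G f' = 0 by apply/eqP; rewrite eq_le E0 energy_ge0.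
  have /eqP := connected_energy0 cG f'0 x s.
  by rewrite f'x f'S // oner_eq0.
split=> //.
  by exists f'; split=> //; rewrite (le_trans Est) // st.
case E: (star A x) st => [|e []] // _ f.
have : e \in star A x by rewrite E mem_head.
rewrite mem_star => /and3P[eG _ ex].
have [f2 f2A Ef2] := extA (fun z => if z == x then f (opposite x e) else f z).
exists f2 => [z|].
  by rewrite !inE => /andP[zx zA]; rewrite f2A // (negPf zx).
apply: le_trans Ef2 _; rewrite (energy_in_setD1 _ x) E big_seq1.
rewrite [X in _ + X](_ : _ = 0) ?addr0; last first.
  have := edge_neq eG; move: ex; rewrite /incident /opposite.
  case: (eqVneq e.1 x) => [->|n1] /=; case: (eqVneq e.2 x) => [->|n2] //=.
  - by rewrite subrr expr0n.
  - by rewrite subrr expr0n.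
rewrite le_eqVlt; apply/orP; left; apply/eqP; apply: eq_bigr => e'.
by rewrite inside_setD1 negb_or => /andP[_ /andP[/negPf -> /negPf ->]].
Qed.

Lemma size_star A x :
  size (star A x) = (\sum_(e <- edges G | inside A e) incident x e)%N.
Proof.
by rewrite size_filter -sum1_count big_mkcondr; apply: eq_bigr => e _; case: ifP.
Qed.

Lemma sum_star A :
  (\sum_(x in A) size (star A x) = (num_edges_in A).*2)%N.
Proof.
under eq_bigr do rewrite size_star.
rewrite exchange_big /= -muln2 /num_edges_in -sum1_count big_distrl /=.
rewrite big_seq_cond [RHS]big_seq_cond.
apply: eq_bigr => e /andP[eG /andP[e1A e2A]].
rewrite (bigD1 e.1) //= (bigD1 e.2) /=; last by rewrite e2A eq_sym edge_neq.
rewrite /incident !eqxx orbT /= big1 // => x /andP[/andP[_ /negPf n1] /negPf n2].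
by rewrite eq_sym n1 eq_sym n2.
Qed.

Lemma card_nbr A x : (#|nbr A x| <= size (star A x))%N.
Proof. by rewrite cardsE (leq_trans (card_size _)) // size_map. Qed.

Lemma nbrP A x y : reflect (exists2 e, e \in edges G &
  inside A e /\ (e = (x, y) \/ e = (y, x))) (y \in nbr A x).
Proof.
apply: (iffP idP) => [|[e eG [eA exy]]]; rewrite inE.
  move=> /mapP[[a b]]; rewrite mem_star => /and3P[eG eA ex] ->.
  exists (a, b) => //; split=> //; move: ex; rewrite /incident /opposite /=.
  by case: (eqVneq a x) => [->|_ /= /eqP ->]; [left|right].
apply/mapP; exists e; first rewrite mem_star eG eA /incident.
  by case: exy => -> /=; rewrite eqxx ?orbT.
have := edge_neq eG; rewrite /opposite; case: exy => -> /=; first by rewrite eqxx.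
by case: eqP.
Qed.

Lemma nbr_sym A x y : (y \in nbr A x) = (x \in nbr A y).
Proof.
by apply/nbrP/nbrP => -[e eG [eA exy]]; exists e => //; split=> //; case: exy; tauto.
Qed.

(* With [f = 1] at [x], [1/2] at its neighbours and [0] elsewhere, at most four
   edges carry a voltage drop, each of at most [1/2]. *)
Lemma unit_cut_chain A x : extendable A -> x \in A -> x \notin S -> 
  size (star A x) = 2%N ->
  {in nbr A x, forall y, y \notin S /\ size (star A y) = 2%N} ->
  S \subset A -> unit_cut x.
Proof.
move=> extA xA xS stx nx SA.
have [f' f'A Ef'] :=
  extA (fun z => if z == x then 1 else if z \in nbr A x then 2^-1 else 0).
exists f'; split.
- move=> s sS; rewrite f'A ?(fintype.subsetP SA) //.
  case: eqP => [sx|_]; first by rewrite -sx sS in xS.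
  by case: ifP => // /nx[]; rewrite sS.
- by rewrite f'A // eqxx.
apply: le_trans Ef' _.
(* [m e] counts the ends of [e] among the neighbours of [x]. Every edge with a voltage drop has such
   an end, so its energy is at most [m e / 4]. *)
pose m (e : V * V) := (\sum_(u in nbr A x) incident u e)%N.
apply: (@le_trans _ _ (\sum_(e <- edges G | inside A e) (m e)%:R / 4)).
  rewrite /energy_in big_seq_cond [leRHS]big_seq_cond.
  apply: ler_sum => e /andP[eG eA].
  have m1 u : u \in nbr A x -> incident u e -> 1 <= (m e)%:R :> R.
    by move=> un eu; rewrite ler1n /m (bigD1 u) //= eu.
  have := edge_neq eG; have [e1x|e1x] := eqVneq e.1 x.
    have n2 : e.2 \in nbr A x.
      by apply/nbrP; exists e => //; split=> //; left; rewrite -e1x -surjective_pairing.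
    rewrite eq_sym e1x => /negPf ->; rewrite n2.
    have := m1 _ n2; rewrite /incident eqxx orbT => /(_ isT); lra.
  have [e2x _|e2x _] := eqVneq e.2 x.
    have n1 : e.1 \in nbr A x.
      by apply/nbrP; exists e => //; split=> //; right; rewrite -e2x -surjective_pairing.
    rewrite n1.
    have := m1 _ n1; rewrite /incident eqxx => /(_ isT); lra.
  have := m1 e.1; have := m1 e.2; rewrite /incident !eqxx orbT.
  have : 0 <= (m e)%:R :> R by [].
  case: (e.1 \in _); case: (e.2 \in _) => [] m0 h2 h1;
    try have := h1 isT isT; try have := h2 isT isT; lra.
rewrite -mulr_suml -natr_sum ler_pdivrMr // mul1r ler_nat /m exchange_big /=.
apply: (@leq_trans (\sum_(u in nbr A x) 2)%N).
  apply: leq_sum => u /nx[_ <-].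
  by rewrite size_star.
by rewrite sum_nat_const (leq_trans (leq_mul (card_nbr A x) (leqnn 2))) // stx.
Qed.

(** The exceptional set consists of the closed neighbourhoods in [A] of [S] and of the vertices of
    degree above 2. Any other vertex is either pruned or, with its neighbours, inside a chain. *)
Lemma core_exceptions A : extendable A -> S \subset A ->
  (num_edges_in A <= #|A|)%N -> (forall x, x \notin A -> unit_cut x) ->
  {in A :\: S, forall x, 1 < size (star A x)}%N ->
  exists2 B : {set V}, (#|B| <= 9 * #|S|)%N & forall x, x \notin B -> unit_cut x.
Proof.
move=> extA SA numA outA deg2.
pose Y := S :|: [set x in A | 2 < size (star A x)]%N.
exists (\bigcup_(y in Y) (y |: nbr A y)); last first.
  move=> x xB; have [xA|] := boolP (x \in A); last exact: outA.
  have notY u : (u == x) || (u \in nbr A x) -> u \notin Y.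
    move=> ux; apply: contra xB => uY; apply/bigcupP; exists u => //.
    by rewrite in_setU1 eq_sym nbr_sym.
  have notYP u : u \in A -> u \notin Y -> u \notin S /\ size (star A u) = 2%N.
    rewrite !inE negb_or => uA /andP[uS]; rewrite uA -leqNgt => u2; split=> //.
    by apply/eqP; rewrite eqn_leq u2 deg2 // inE uS.
  have [||xS x2] := notYP x => //; first by rewrite notY ?eqxx.
  apply: unit_cut_chain extA xA xS x2 _ SA => y yx.
  apply: notYP; last by rewrite notY // yx orbT.
  by have /nbrP[e _ [/andP[e1 e2] [E|E]]] := yx; move: e1 e2; rewrite E.
(* For a degree [d >= 3], [d + 1 <= 4 (d - 2)]. *)
have cardS y : y \in Y -> (#|y |: nbr A y| <=
    if y \in S then (size (star A y)).+1 else 4 * (size (star A y) - 2))%N.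
  move=> yY; apply: (@leq_trans (size (star A y)).+1).
    by rewrite cardsU1 -add1n leq_add ?card_nbr ?leq_b1.
  by move: yY; rewrite !inE; case: (y \in S) => //= /andP[_]; lia.
(* By the handshake lemma, as [A] spans at most [#|A|] edges. The neighbourhoods then have total
   size at most [#|S| + 4 (2 #|S|)], whence the 9. *)
have dS : (\sum_(x in S) size (star A x) +
    \sum_(x in A :\: S) (size (star A x) - 2) <= 2 * #|S|)%N.
  have := sum_star A; rewrite (big_setID S) /= (finset.setIidPr SA).
  have -> : (\sum_(x in A :\: S) size (star A x) =
      \sum_(x in A :\: S) (size (star A x) - 2) + #|A :\: S| * 2)%N.
    rewrite -sum_nat_const -big_split /=; apply: eq_bigr => x xAS.
    by rewrite subnK ?deg2.
  have := cardsID S A; rewrite (finset.setIidPr SA) => cA; move: numA; rewrite -cA.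
  by rewrite -[(num_edges_in A <= _)%N]leq_double => h e; move: h; rewrite -e; clear; lia.
apply: (@leq_trans (\sum_(y in Y) #|y |: nbr A y|)).
  elim/big_rec2: _ => [|y m U _ h]; first by rewrite cards0.
  by rewrite (leq_trans (leq_card_setU _ _)) // leq_add2l.
have YA : Y \subset A.
  by rewrite finset.subUset SA; apply/fintype.subsetP => x; rewrite inE => /andP[].
pose F y := if y \in S then (size (star A y)).+1 else (4 * (size (star A y) - 2))%N.
apply: (@leq_trans (\sum_(y in Y) F y)); first exact: leq_sum.
apply: (@leq_trans (\sum_(y in A) F y)).
  by rewrite [leqRHS](big_setID Y) /= (finset.setIidPr YA) leq_addr.
rewrite (big_setID S) /= (finset.setIidPr SA).
rewrite (eq_bigr (fun y => 1 + size (star A y))%N) => [|y yS]; last by rewrite /F yS.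
rewrite [X in (_ + X)%N](eq_bigr (fun y => 4 * (size (star A y) - 2)))%N; last first.
  by move=> y; rewrite !inE /F => /andP[/negPf ->].
rewrite big_split /= sum1_card -big_distrr /=; move: dS; clear; lia.
Qed.

(** Vertices of degree at most 1 outside [S] are removed one by one. By [prune_leaf] the degree is
    exactly 1, so each removal costs one edge and one vertex and keeps the edge bound. *)
Lemma unit_cuts : (num_edges G <= #|V|)%N ->
  exists2 B : {set V}, (#|B| <= 9 * #|S|)%N & forall x, x \notin B -> unit_cut x.
Proof.
move=> numG.
suff h m A : (#|A| <= m)%N -> extendable A -> S \subset A ->
    (num_edges_in A <= #|A|)%N -> (forall x, x \notin A -> unit_cut x) ->
    exists2 B : {set V}, (#|B| <= 9 * #|S|)%N & forall x, x \notin B -> unit_cut x.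
  apply: (h _ [set: V] (leqnn _)) => [f|||x].
  - exists f => //; rewrite le_eqVlt; apply/orP; left; apply/eqP.
    by rewrite /energy_in; apply: eq_bigl => e; rewrite /inside !inE.
  - exact: finset.subsetT.
  - by rewrite cardsT (leq_trans (count_size _ _)).
  - by rewrite inE.
elim: m A => [|m IH] A Am extA SA numA outA.
  have [s sS] := S_gt0; have /card_gt0P : exists s, s \in A.
    by exists s; rewrite (fintype.subsetP SA).
  by rewrite ltnNge Am.
have [/existsP[x /andP[xAS xdeg]]|] :=
  boolP [exists x, (x \in A :\: S) && (size (star A x) <= 1)%N]; last first.
  rewrite negb_exists => /forallP deg2; apply: (core_exceptions extA) => // x xAS.
  by have := deg2 x; rewrite xAS /= -ltnNge.
have /setDP[xA xS] := xAS.
have [cx extA' stx] := prune_leaf SA extA xA xS xdeg.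
have := cardsD1 x A; rewrite xA add1n => cA.
apply: IH extA' _ _ _.
- by rewrite -ltnS -cA.
- apply/fintype.subsetP => s sS; rewrite !inE (fintype.subsetP SA) // andbT.
  by apply: contraNneq xS => <-.
- by have := num_edges_in_setD1 A x; rewrite stx => E; rewrite -ltnS -cA -addn1 -E.
- move=> y; rewrite !inE negb_and negbK => /orP[/eqP -> //|]; exact: outA.
Qed.

End Pruning.

(** * Comparison of the extremal averages *)

Section Bounds.
Variables (R : realType) (alpha : R).
Hypothesis alpha_ge2 : 2 <= alpha.

Lemma alpha_ge0 : 0 <= alpha.
Proof. by move: alpha_ge2; lra. Qed.

Lemma b_min_lb n (G : multigraph 'I_n.+1) rho (c : \bar R) :
  (num_edges G)%:R <= alpha * n%:R / 2 -> (root_resistance R G rho <= c)%E ->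
  (b_min alpha n <= c)%E.
Proof. by move=> GE; apply: le_trans; apply: ereal_inf_lbound; exists (G, rho). Qed.

(* The star, seen as a collapse of the empty graph. *)
Lemma b_min_le1 n : (0 < n)%N -> (b_min alpha n <= 1)%E.
Proof.
move=> n0; pose G := @Multigraph 'I_0 [::] isT.
have n0' : 0 < n%:R :> R by rewrite ltr0n.
apply: (@b_min_lb n (collapse n G finset.set0) ord_max).
  have GE := num_edges_collapse n G finset.set0; rewrite cards0 in GE.
  apply: (@le_trans _ _ n%:R); first by rewrite ler_nat; exact: GE.
  by move: alpha_ge2; nra.
apply: le_trans (@root_resistance_collapse 0 n G finset.set0 R (fun=> 0) _ _ n0) _.
- by move=> x.
- by move=> f _ [].
rewrite lee_fin big_ord0 cards0 add0r.
by change (n%:R^-1 * n%:R <= 1 :> R); rewrite mulVf ?gt_eqF.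
Qed.

Lemma a_min_le_b_min n :
  (0 < n)%N -> (a_min alpha n.+1 <= 2%:E * b_min alpha n)%E.
Proof.
move=> n0; have [[G rho] /= GE <-] := b_min_attained n alpha_ge0.
apply: le_trans (avg_le_root_resistance R G rho n0).
apply: ereal_inf_lbound; exists G => //=; apply: le_trans GE _.
by rewrite ler_pM2r ?invr_gt0 // ler_wpM2l ?alpha_ge0 // ler_nat.
Qed.

Lemma a_min_ge0 n : (0 < n)%N -> (0 <= a_min alpha n)%E.
Proof.
by move=> n0; have [G _ <-] := a_min_attained n alpha_ge0; exact: avg_resistance_ge0.
Qed.

Lemma b_min_ge0 n : (0 < n)%N -> (0 <= b_min alpha n)%E.
Proof.
move=> n0; have := le_trans (a_min_ge0 (ltn0Sn n)) (a_min_le_b_min n0).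
by rewrite pmule_rge0 // lte_fin.
Qed.

Lemma b_min_le_a_min_gt2 k : 2 < alpha -> (0 < k)%N ->
  exists d, forall n A, (0 < n)%N -> a_min alpha n = A%:E ->
  (b_min alpha (n + d) <= (A / 2 * (1 + k%:R^-1) + (k + d)%:R / n%:R)%:E)%E.
Proof.
(* The [d] extra vertices raise the edge budget by [alpha d / 2], which for this [d] pays for the at
   most [k + d] pendant edges. *)
move=> alpha2 k0; pose d := (Num.truncn (k%:R / (alpha / 2 - 1))).+1.
have hd : k%:R + d%:R <= alpha * d%:R / 2.
  have p : 0 < alpha / 2 - 1 by lra.
  have := truncnS_gt (k%:R / (alpha / 2 - 1)); rewrite -/d ltr_pdivrMr //; lra.
exists d => n A n0 aA.
have [G GE GA] := a_min_attained n alpha_ge0; rewrite aA in GA.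
have [S [r [_ Sk rA r0 rP]]] := avg_resistance_ground n0 k0 GA.
have n0' : 0 < n%:R :> R by rewrite ltr0n.
have k0' : 0 < k%:R^-1 :> R by rewrite invr_gt0 ltr0n.
have A0 : 0 <= A by rewrite -lee_fin -aA a_min_ge0.
have d0 : 0 <= d%:R :> R by [].
have Sk' : #|S|%:R <= k%:R :> R by rewrite ler_nat.
apply: (@b_min_lb _ (collapse d G S) ord_max).
  apply: (@le_trans _ _ (num_edges G + (#|S| + d))%:R).
    by rewrite ler_nat num_edges_collapse.
  rewrite !natrD; rewrite /= in GE; lra.
have nd0 : (0 < n + d)%N by rewrite ltn_addr.
apply: le_trans (root_resistance_collapse r0 rP nd0) _; rewrite lee_fin.
have nd : 0 < (n + d)%:R :> R by rewrite ltr0n.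
have C0 : 0 <= (k + d)%:R / n%:R :> R by rewrite divr_ge0.
rewrite ler_pdivrMl // mulrDr lerD //.
  apply: le_trans rA _; rewrite -mulrA ler_wpM2r ?ler_nat ?leq_addr //.
  by rewrite mulr_ge0 ?divr_ge0 ?addr_ge0 // ltW.
apply: (@le_trans _ _ (k + d)%:R); first by rewrite ler_nat leq_add2r.
have n0N : n%:R != 0 :> R by rewrite gt_eqF.
by rewrite -{1}(divfK n0N (k + d)%:R) mulrC ler_wpM2r // ler_nat leq_addr.
Qed.

(** A minimiser has at most [n] edges, so [unit_cuts] gives [1 <= r x] off at most [9 k] vertices,
    while grounding bounds the sum of [r] from above. *)
Lemma a_min_ge_2 k : alpha = 2 -> (0 < k)%N ->
  forall n A, (0 < n)%N -> a_min alpha n = A%:E ->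
  1 <= A / 2 * (1 + k%:R^-1) + (9 * k)%:R / n%:R.
Proof.
move=> alpha2 k0 n A n0 aA.
have [G GE GA] := a_min_attained n alpha_ge0; rewrite aA in GA.
have [S [r [S0 Sk rA r0 rP]]] := avg_resistance_ground n0 k0 GA.
have cG : connected_graph G.
  by apply: contrapT => nG; move: GA; rewrite avg_resistance_disconnected.
have [|B BS Bcut] := @unit_cuts R _ G cG S S0.
  rewrite card_ord -(ler_nat R); move: GE; rewrite /= alpha2; lra.
have n0' : 0 < n%:R :> R by rewrite ltr0n.
have r1 x : x \notin B -> 1 <= r x.
  move=> /Bcut[f [fS fx fE]]; have := rP f fS x; rewrite fx expr1n => h.
  apply: le_trans h _.
  by rewrite ler_piMr.
rewrite -(ler_pM2l n0') mulr1 mulrDr mulrA [X in _ + X]mulrC divfK ?gt_eqF //.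
apply: le_trans (lerD rA (lexx _)).
apply: (@le_trans _ _ ((\sum_(x in ~: B) 1) + #|B|%:R)).
  rewrite sumr_const -natrD addnC.
  by rewrite -[X in X%:R <= _]card_ord -(cardsC B).
rewrite lerD //; last by rewrite ler_nat (leq_trans BS) // leq_mul2l Sk.
rewrite [leRHS](bigID (fun x => x \in ~: B)) /= ler_wpDr ?sumr_ge0 //.
by apply: ler_sum => x; rewrite inE; exact: r1.
Qed.

End Bounds.

Lemma b_min_le_a_min (R : realType) (alpha eps : R) : 2 <= alpha -> 0 < eps ->
  exists d N, forall n A, (N <= n)%N -> a_min alpha n = A%:E -> A <= 2 ->
  (b_min alpha (n + d) <= (A / 2 + eps)%:E)%E.
Proof.
(* [k] is fixed first, so that [A / (2 k) <= 1 / k <= eps / 2]; then [n] is taken large enough for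
   [C / n <= eps / 2], as [d] and [C] do not depend on [n]. *)
move=> alpha2 eps0; pose k := (Num.truncn (2 / eps)).+1.
have k0 : (0 < k)%N by [].
have hk : k%:R^-1 <= eps / 2.
  rewrite -[leLHS]div1r ler_pdivrMr ?ltr0n //.
  have := truncnS_gt (2 / eps); rewrite -/k ltr_pdivrMr //; lra.
suff [d [C h]] : exists d C : nat, forall n A, (0 < n)%N -> a_min alpha n = A%:E ->
    (b_min alpha (n + d) <= (A / 2 * (1 + k%:R^-1) + C%:R / n%:R)%:E)%E.
  exists d, (Num.truncn (2 * C%:R / eps)).+1 => n A Nn aA A2.
  have n0 : (0 < n)%N by apply: leq_trans Nn.
  apply: le_trans (h _ _ n0 aA) _; rewrite lee_fin.
  have hC : C%:R / n%:R <= eps / 2.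
    rewrite ler_pdivrMr ?ltr0n //.
    have : (Num.truncn (2 * C%:R / eps)).+1%:R <= n%:R :> R by rewrite ler_nat.
    have := truncnS_gt (2 * C%:R / eps); rewrite ltr_pdivrMr //; nra.
  have k1 : 0 < k%:R^-1 :> R by rewrite invr_gt0 ltr0n.
  have : A / 2 * k%:R^-1 <= k%:R^-1 by rewrite ler_piMl ?(ltW k1) //; lra.
  lra.
have [alpha_eq2|alphaN2] := eqVneq alpha 2.
  exists 0%N, (9 * k)%N => n A n0 aA; rewrite addn0.
  apply: le_trans (b_min_le1 alpha2 n0) _; rewrite lee_fin.
  exact: (a_min_ge_2 alpha2 alpha_eq2 k0 n0 aA).
have alpha_gt2 : 2 < alpha by rewrite lt_neqAle eq_sym alphaN2.
by have [d h] := b_min_le_a_min_gt2 alpha2 alpha_gt2 k0; exists d, (k + d)%N.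
Qed.

(** * Passage to the limit *)

(** For large [n], [v n] lies between [u n.+1 / 2] and [u (n - d) / 2 + eps]. The shift [d] may
    depend on [eps], being fixed before [n]. *)
Lemma cvg_half_iff (R : realType) (u v : nat -> R) :
  (forall n, (0 < n)%N -> u n.+1 <= 2 * v n) ->
  (forall eps, 0 < eps -> exists d N, forall n, (N <= n)%N ->
     v (n + d)%N <= u n / 2 + eps) ->
  forall l : R, (u @ \oo --> l)%classic <-> (v @ \oo --> l / 2)%classic.
Proof.
move=> uv vu l; split=> /cvgrPdist_lt h; apply/cvgrPdist_lt => eps eps0.
  have [N0 _ {}h] := h _ eps0.
  have e2 : 0 < eps / 2 by rewrite divr_gt0.
  have [d [N vuN]] := vu _ e2.
  exists (N + N0 + d).+1 => // n /= Nn.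
  have := vuN (n - d)%N; rewrite subnK; last by lia.
  have := uv n; have := h n.+1; have := h (n - d)%N; rewrite /= !ltr_norml.
  move=> /(_ ltac:(lia))/andP[? ?] /(_ ltac:(lia))/andP[? ?]
    /(_ ltac:(lia)) ? /(_ ltac:(lia)) ?.
  by apply/andP; split; lra.
(* Two errors, each doubled in passing from [v] to [u]. *)
have e4 : 0 < eps / 4 by rewrite divr_gt0.
have [N0 _ {}h] := h _ e4.
have [d [N vuN]] := vu _ e4.
exists (N + N0).+2 => // -[//|n] /= Nn.
have := vuN n.+1; have := uv n; have := h n; have := h (n.+1 + d)%N.
rewrite /= !ltr_norml.
move=> /(_ ltac:(lia))/andP[? ?] /(_ ltac:(lia))/andP[? ?]
    /(_ ltac:(lia)) ? /(_ ltac:(lia)) ?.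
by apply/andP; split; lra.
Qed.

Lemma cvg_bounded_ereal (R : realType) (a : nat -> \bar R) (c : R) :
  (\forall n \near \oo%classic, 0 <= a n <= c%:E)%E -> cvg (a @ \oo)%classic ->
  exists l : R, (a @ \oo --> l%:E)%classic.
Proof.
move=> ac ca; suff finl : limn a \is a fin_num.
  by exists (fine (limn a)); rewrite fineK.
apply/fin_real; rewrite (@lt_le_trans _ _ 0%E) ?ltNye //=.
  rewrite (@le_lt_trans _ _ c%:E) ?ltey //.
  by apply: lime_le => //; apply: filterS ac => n /andP[].
by apply: lime_ge => //; apply: filterS ac => n /andP[].
Qed.

Theorem theorem6 (R : realType) (alpha : R) :
  2 <= alpha -> b_lim alpha = (a_lim alpha * (2^-1)%:E)%E.
Proof.
move=> alpha2.
have b1 n : (0 < n)%N -> (0 <= b_min alpha n <= 1)%E.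
  by move=> n0; rewrite b_min_ge0 ?b_min_le1.
(* The index starts at 2 because the upper bound comes from [b_min] at [n - 1], which must be
   positive. It later supplies [A <= 2] in [b_min_le_a_min]. *)
have a2 n : (1 < n)%N -> (0 <= a_min alpha n <= 2%:E)%E.
  case: n => [//|n]; rewrite ltnS => n0; rewrite a_min_ge0 //=.
  apply: le_trans (a_min_le_b_min alpha2 n0) _.
  by rewrite -[leRHS]mule1 lee_pmul2l ?lte_fin // b_min_le1.
have bfin n : (0 < n)%N -> b_min alpha n \is a fin_num.
  move=> /b1/andP[b0 b1']; apply/fin_real.
  by rewrite (lt_le_trans _ b0) ?ltNye // (le_lt_trans b1') ?ltey.
have afin n : (1 < n)%N -> a_min alpha n \is a fin_num.
  move=> /a2/andP[a0 a2']; apply/fin_real.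
  by rewrite (lt_le_trans _ a0) ?ltNye // (le_lt_trans a2') ?ltey.
have ab (l : R) : (a_min alpha @ \oo --> l%:E)%classic <->
    (b_min alpha @ \oo --> (l / 2)%:E)%classic.
  have afn : (\forall n \near \oo%classic, a_min alpha n \is a fin_num) by exists 2%N.
  have bfn : (\forall n \near \oo%classic, b_min alpha n \is a fin_num) by exists 1%N.
  suff h : (fine \o a_min alpha @ \oo --> l)%classic <->
      (fine \o b_min alpha @ \oo --> l / 2)%classic.
    by split=> /fine_cvgP[_ /h lh]; apply/fine_cvgP.
  apply: cvg_half_iff => [n n0|eps eps0] /=.
    rewrite -lee_fin EFinM !fineK ?afin ?bfin ?ltnS //.
    exact: a_min_le_b_min.
  have [d [N h]] := b_min_le_a_min alpha2 eps0.
  exists d, N.+2 => n Nn; rewrite -lee_fin fineK ?bfin //; last by lia.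
  apply: h; [lia|by rewrite fineK // afin; lia|].
  have n1 : (1 < n)%N by lia.
  by rewrite -lee_fin fineK ?afin //; have /andP[] := a2 n n1.
have acvg : (cvg (a_min alpha @ \oo) -> exists l : R, a_min alpha @ \oo --> l%:E)%classic.
  by apply: (@cvg_bounded_ereal R _ 2); exists 2%N.
have bcvg : (cvg (b_min alpha @ \oo) -> exists l : R, b_min alpha @ \oo --> l%:E)%classic.
  by apply: (@cvg_bounded_ereal R _ 1); exists 1%N.
rewrite /b_lim /a_lim.
have [/acvg[l al]|nca] := pselect (cvg (a_min alpha @ \oo)%classic).
  have /ab bl := al.
  by rewrite (cvg_lim (@ereal_hausdorff R) al) (cvg_lim (@ereal_hausdorff R) bl) -EFinM.
(* The two sequences converge or diverge together; on a divergent sequence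
   [lim] takes the default value [0], for which the identity also holds. *)
have ncb : ~ cvg (b_min alpha @ \oo)%classic.
  move=> /bcvg[m bm]; apply: nca; apply/cvg_ex; exists (m * 2)%:E; apply/ab.
  by rewrite mulfK.
by rewrite (dvgP nca) (dvgP ncb) (mul0e (2^-1)%:E).
Qed.
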